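(* Let $\Phi=(\phi_n)$, $\Psi=(\psi_n)$ be sequences in $\mathcal H$ and let $m=(m_n)$ be a complex scalar sequence such that $M_{m,\Phi,\Psi}$ is invertible. Consider the following conditions. $\mathcal P_1$: the sequence $(|m_n|\cdot\|\phi_n\|\cdot\|\psi_n\|)$ is norm-bounded below and $M_{m,\Phi,\Psi}$ is unconditionally convergent. $\widetilde{\mathcal P}_2$: there exist scalar sequences $(c_n)$ and $(d_n)$ with $m_n=c_n\overline{d_n}$ for every $n$ such that $(c_n\phi_n)$ and $(d_n\psi_n)$ are $\|\cdot\|$-semi-normalized and frames for $\mathcal H$. $\widetilde{\mathcal P}_3$: there exist scalar sequences $(c_n)$ and $(d_n)$ with $m_n=c_n\overline{d_n}$ for every $n$ such that $(c_n\phi_n)$ and $(d_n\psi_n)$ are frames for $\mathcal H$. Then $\mathcal P_1\Leftrightarrow\widetilde{\mathcal P}_2$ and $\widetilde{\mathcal P}_2\Rightarrow\widetilde{\mathcal P}_3$, while $\widetilde{\mathcal P}_3$ does not in general imply $\mathcal P_1$ (that is, there exist $m,\Phi,\Psi$ with $M_{m,\Phi,\Psi}$ invertible satisfying $\widetilde{\mathcal P}_3$ but not $\mathcal P_1$).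
   Context: $\mathcal H$ is a complex Hilbert space having an orthonormal basis $(e_n)_{n\in\mathbb N}$ indexed by $\mathbb N$; all sequences and sums are indexed by $\mathbb N$. The multiplier is $M_{m,\Phi,\Psi}f=\sum_{n=1}^\infty m_n\langle f,\psi_n\rangle\phi_n$, where $\langle\cdot,\cdot\rangle$ is linear in the first argument. It is unconditionally convergent if for every $f\in\mathcal H$ the series converges unconditionally (i.e. it converges for every permutation of its terms). It is invertible if the series converges for every $f\in\mathcal H$ and the resulting linear operator $M:\mathcal H\to\mathcal H$ has a bounded operator $M^{-1}:\mathcal H\to\mathcal H$ with $MM^{-1}=M^{-1}M=I_{\mathcal H}$. A scalar sequence $(x_n)$ is norm-bounded below if $\inf_n|x_n|>0$. A sequence $(\phi_n)$ in $\mathcal H$ is $\|\cdot\|$-semi-normalized if there are constants $0<a\le b<\infty$ with $a\le\|\phi_n\|\le b$ for all $n$. It is a frame for $\mathcal H$ if there are constants $0<A\le B<\infty$ with $A\|h\|^2\le\sum_n|\langle h,\phi_n\rangle|^2\le B\|h\|^2$ for all $h\in\mathcal H$. *)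

(* Defs.v *)
From HB Require Import structures.
From mathcomp Require Import all_boot all_order all_algebra.
From mathcomp Require Import complex.
From mathcomp Require Import all_classical all_reals all_analysis.
Import Order.TTheory GRing.Theory Num.Theory.
Import numFieldNormedType.Exports.

Set Implicit Arguments.
Unset Strict Implicit.
Unset Printing Implicit Defensive.

Local Open Scope classical_set_scope.
Local Open Scope ring_scope.

(* Norms of complex spaces (and moduli of complex numbers) live in R[i]; they
   are nonnegative reals there, so taking the real part loses nothing. *)
Definition rnorm (R : realType) (V : normedZmodType R[i]) (x : V) : R :=
  complex.Re `|x|.

Section Multipliers.
Variables (R : realType) (H : completeNormedModType R[i]).
Variable (dot : {dot H for (@Num.conj R[i])}).

(* {dot H for Num.conj} is linear in its first argument and conjugate-linear in
   its second; the condition makes H a Hilbert space with inner product dot. *)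
Definition induces_norm : Prop := forall x : H, dot x x = `|x| ^+ 2.

Definition orthonormal_basis (e : nat -> H) : Prop :=
  (forall i j, dot (e i) (e j) = (i == j)%:R) /\
  (forall f, series (fun n => dot f (e n) *: e n) @ \oo --> f).

Definition multiplier_term (m : nat -> R[i]) (phi psi : nat -> H) (f : H)
  : nat -> H := fun n => (m n * dot f (psi n)) *: phi n.

Definition multiplier (m : nat -> R[i]) (phi psi : nat -> H) (f : H) : H :=
  limn (series (multiplier_term m phi psi f)).

Definition unconditionally_convergent (m : nat -> R[i]) (phi psi : nat -> H)
  : Prop :=
  forall (f : H) (s : nat -> nat), bijective s ->
    cvgn (series (multiplier_term m phi psi f \o s)).

Definition bounded_operator (T : H -> H) : Prop :=
  exists C : R, forall x, rnorm (T x) <= C * rnorm x.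

Definition multiplier_invertible (m : nat -> R[i]) (phi psi : nat -> H)
  : Prop :=
  (forall f, cvgn (series (multiplier_term m phi psi f))) /\
  exists T : {linear H -> H},
    [/\ bounded_operator T,
        forall f, multiplier m phi psi (T f) = f &
        forall f, T (multiplier m phi psi f) = f].

Definition norm_bounded_below (x : nat -> R[i]) : Prop :=
  0 < inf (range (fun n => rnorm (x n))).

Definition semi_normalized (phi : nat -> H) : Prop :=
  exists a b : R, [/\ 0 < a, a <= b & forall n, a <= rnorm (phi n) <= b].

Definition frame (phi : nat -> H) : Prop :=
  exists A B : R, [/\ 0 < A, A <= B & forall h : H,
    ((A * rnorm h ^+ 2)%:E
       <= \sum_(0 <= n <oo) (rnorm (dot h (phi n)) ^+ 2)%:E
       <= (B * rnorm h ^+ 2)%:E)%E].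

Definition P1 (m : nat -> R[i]) (phi psi : nat -> H) : Prop :=
  norm_bounded_below (fun n => `|m n| * `|phi n| * `|psi n|) /\
  unconditionally_convergent m phi psi.

Definition P2 (m : nat -> R[i]) (phi psi : nat -> H) : Prop :=
  exists c d : nat -> R[i],
    [/\ forall n, m n = c n * Num.conj (d n),
        semi_normalized (fun n => c n *: phi n),
        semi_normalized (fun n => d n *: psi n),
        frame (fun n => c n *: phi n) &
        frame (fun n => d n *: psi n)].

Definition P3 (m : nat -> R[i]) (phi psi : nat -> H) : Prop :=
  exists c d : nat -> R[i],
    [/\ forall n, m n = c n * Num.conj (d n),
        frame (fun n => c n *: phi n) &
        frame (fun n => d n *: psi n)].

End Multipliers.

(* Main.v *)
(* P1 => P2: unconditional convergence bounds, for each f, all signed partial sums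
   of the series; by uniform boundedness the bound is C |f|.  Since signs can be
   chosen with |sum_n +-x_n|^2 >= sum_n |x_n|^2, this gives
   sum_n |m_n <f, psi_n>|^2 |phi_n|^2 <= C^2 |f|^2, and the same bound for the
   formal adjoint, in which phi and psi are exchanged.  With c_n = 1 / |phi_n| and
   d_n = conj(m_n) |phi_n| the sequences c phi and d psi are then Bessel, the former
   because |m_n| |phi_n| |psi_n| is bounded below; a bounded inverse of the
   multiplier turns Bessel sequences into frames.
   P2 => P1: a synthesis series of a Bessel sequence with square-summable
   coefficients is Cauchy, and the Bessel property is invariant under permutations.
   P3 does not imply P1: take m = 1 and phi = psi = (0, e_0, e_1, ...). *)
Require Import Defs.
From mathcomp Require Import all_boot all_order all_algebra.
From mathcomp Require Import complex.
From mathcomp Require Import all_classical all_reals all_analysis.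
From mathcomp Require Import ring lra.
Import Order.TTheory GRing.Theory Num.Theory.
Import numFieldNormedType.Exports.
Set Implicit Arguments.
Unset Strict Implicit.
Unset Printing Implicit Defensive.
Local Open Scope classical_set_scope.
Local Open Scope ring_scope.

(** * Norms and moduli as real numbers *)

Section RealNorm.
Variables (R : realType).

Section NormedZmod.
Variable V : normedZmodType R[i].
Implicit Types x y : V.

Lemma rnormE x : `|x| = (rnorm x)%:C%C.
Proof. by rewrite /rnorm RRe_real// ger0_real. Qed.

Lemma rnorm_ge0 x : 0 <= rnorm x.
Proof. by rewrite -lecR -rnormE; exact: normr_ge0. Qed.

Lemma rnorm0 : rnorm (0 : V) = 0.
Proof. by rewrite /rnorm normr0. Qed.

Lemma rnorm_eq0 x : (rnorm x == 0) = (x == 0).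
Proof. by rewrite -(normr_eq0 x) rnormE eq_complex /= eqxx andbT. Qed.

Lemma rnormD x y : rnorm (x + y) <= rnorm x + rnorm y.
Proof. by rewrite -lecR rmorphD/= -!rnormE ler_normD. Qed.

Lemma rnormN x : rnorm (- x) = rnorm x.
Proof. by rewrite /rnorm normrN. Qed.

Lemma rnormB x y : rnorm (x - y) = rnorm (y - x).
Proof. by rewrite -rnormN opprB. Qed.

Lemma rnorm_sum I (r : seq I) (P : pred I) (F : I -> V) :
  rnorm (\sum_(i <- r | P i) F i) <= \sum_(i <- r | P i) rnorm (F i).
Proof.
elim/big_ind2: _ => [|x1 x2 y1 y2 h1 h2|//]; first by rewrite rnorm0.
exact: le_trans (rnormD _ _) (lerD h1 h2).
Qed.

End NormedZmod.

Implicit Types z : R[i].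

Lemma rnormM z1 z2 : rnorm (z1 * z2) = rnorm z1 * rnorm z2.
Proof. by apply: complexI; rewrite rmorphM/= -!rnormE normrM. Qed.

Lemma rnorm_conj z : rnorm (Num.conj z) = rnorm z.
Proof. by apply: complexI; rewrite -!rnormE norm_conjC. Qed.

Lemma rnorm_real (t : R) : rnorm (t%:C%C : R[i]) = `|t|.
Proof. by apply: complexI; rewrite -rnormE normc_def/= expr0n/= addr0 sqrtr_sqr. Qed.

Lemma rnorm1 : rnorm (1 : R[i]) = 1.
Proof. by rewrite /rnorm normr1. Qed.

Lemma rnorm_norm (V : normedZmodType R[i]) (x : V) : rnorm (`|x| : R[i]) = rnorm x.
Proof. by rewrite rnormE rnorm_real ger0_norm ?rnorm_ge0. Qed.

Lemma rnormV z : rnorm z^-1 = (rnorm z)^-1.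
Proof. by apply: complexI; rewrite fmorphV/= -!rnormE normfV. Qed.

Lemma conj_mulr_norm z : z * Num.conj z = ((rnorm z) ^+ 2)%:C%C.
Proof. by rewrite -normCK rnormE rmorphXn. Qed.

End RealNorm.

(** * Convergence and completeness with real tolerances *)

Section RealDistance.
Variables (R : realType) (V : normedModType R[i]).

Lemma rnormZ (a : R[i]) (x : V) : rnorm (a *: x) = rnorm a * rnorm x.
Proof. by apply: complexI; rewrite rmorphM/= -!rnormE normrZ. Qed.

(** Positive elements of [R[i]] are real, so quantifying over them amounts to quantifying over
    positive reals. *)
Lemma pos_complexP (P : R[i] -> Prop) :
  (forall eps, 0 < eps -> P eps) <-> (forall eps : R, 0 < eps -> P eps%:C%C).
Proof.
split=> h eps e0; first by apply: h; rewrite ltcR.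
by rewrite -(RRe_real (gtr0_real e0)); apply: h; rewrite -ltcR RRe_real ?gtr0_real.
Qed.

Lemma cvgn_rnormP (u : nat -> V) (l : V) :
  u @ \oo --> l <->
  forall eps : R, 0 < eps ->
    exists N, forall n, (N <= n)%N -> rnorm (l - u n) < eps.
Proof.
rewrite cvgrPdist_lt (pos_complexP (fun e => \forall t \near \oo, `|l - u t| < e)).
split=> h eps e0.
  have [N _ hN] := h _ e0; exists N => n Nn.
  by have /= := hN n Nn; rewrite rnormE ltcR.
have [N hN] := h _ e0; exists N => // n /= Nn.
by rewrite rnormE ltcR hN.
Qed.

End RealDistance.

Section Completeness.
Variables (R : realType) (V : completeNormedModType R[i]).

Lemma cvgn_cauchy_rnorm (u : nat -> V) :
  (forall eps : R, 0 < eps ->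
     exists N, forall m n, (N <= m)%N -> (N <= n)%N -> rnorm (u m - u n) < eps) ->
  cvgn u.
Proof.
move=> h; apply/cauchy_cvgP; rewrite -cauchy_ballP.
apply/(pos_complexP (fun e => \forall p \near (u @ \oo, u @ \oo), ball p.1 e p.2)) => eps e0.
have [N hN] := h _ e0.
exists (u @` [set n | (N <= n)%N], u @` [set n | (N <= n)%N]).
  by split; exists N => // n /= Nn; exists n.
case=> x y /= [[n Nn <-] [m Nm <-]].
by rewrite -ball_normE /= rnormE ltcR hN.
Qed.

End Completeness.

(** * Inner product and Cauchy-Schwarz inequality *)

Section InnerProduct.
Variables (R : realType) (H : completeNormedModType R[i]).
Variable dot : {dot H for (@Num.conj R[i])}.
Hypothesis dot_norm : induces_norm dot.
Implicit Types x y : H.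

Lemma dotC x y : dot x y = Num.conj (dot y x).
Proof. by rewrite hermC expr0 mul1r. Qed.

Lemma rnorm_dotC x y : rnorm (dot x y) = rnorm (dot y x).
Proof. by rewrite dotC rnorm_conj. Qed.

Lemma dotxx x : dot x x = (rnorm x ^+ 2)%:C%C.
Proof. by rewrite dot_norm rnormE rmorphXn. Qed.

Lemma dotZl a x y : dot (a *: x) y = a * dot x y.
Proof. exact: linearZl_LR. Qed.

Lemma dotZr a x y : dot x (a *: y) = Num.conj a * dot x y.
Proof. exact: linearZr_LR. Qed.

Lemma dot_suml I (r : seq I) (P : pred I) (F : I -> H) y :
  dot (\sum_(i <- r | P i) F i) y = \sum_(i <- r | P i) dot (F i) y.
Proof. exact: linear_sumlz. Qed.

Lemma dotDl x1 x2 y : dot (x1 + x2) y = dot x1 y + dot x2 y.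
Proof. exact: linearDl. Qed.

Lemma cauchy_schwarz x y : rnorm (dot x y) <= rnorm x * rnorm y.
Proof.
have [->|y0] := eqVneq y 0.
  by rewrite linear0r !rnorm0 mulr0.
have ny : 0 < rnorm y by rewrite lt_def rnorm_ge0 rnorm_eq0 y0.
(* [w] is the component of [x] orthogonal to [y], scaled by [|y|^2] to avoid a division; the
   inequality is [|w|^2 >= 0] expanded. *)
pose w := (rnorm y ^+ 2)%:C%C *: x - dot x y *: y.
have : rnorm w ^+ 2 = rnorm y ^+ 2 * (rnorm y ^+ 2 * rnorm x ^+ 2 - rnorm (dot x y) ^+ 2).
  apply: complexI; rewrite -dotxx /w.
  rewrite linearBl linearBr/= linearBr/= !dotZl !dotZr !dotxx.
  rewrite (dotC y x).
  have -> : Num.conj ((rnorm y ^+ 2)%:C%C : R[i]) = (rnorm y ^+ 2)%:C%C.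
    by apply: conj_Creal; rewrite complex_real.
  have h := conj_mulr_norm (dot x y).
  by rewrite expr2 rmorphM/= in h; rewrite !(rmorphM, rmorphB)/= -h; ring.
move=> hw.
have : 0 <= rnorm y ^+ 2 * (rnorm y ^+ 2 * rnorm x ^+ 2 - rnorm (dot x y) ^+ 2).
  by rewrite -hw exprn_ge0 ?rnorm_ge0.
rewrite pmulr_rge0 ?exprn_gt0// subr_ge0 -exprMn ler_sqr ?nnegrE ?mulr_ge0 ?rnorm_ge0//.
by rewrite mulrC.
Qed.

End InnerProduct.

(** * Rearranging indices *)

Section Rearrangement.

(** For [M] above all of [s 0, ..., s (N-1)], these distinct indices form part of the first [M], and
    the other terms are nonnegative. *)
Lemma ler_sum_injective (R : realType) (F : nat -> R) (s : nat -> nat) N :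
  injective s -> (forall n, 0 <= F n) ->
  exists M, \sum_(0 <= k < N) F (s k) <= \sum_(0 <= k < M) F k.
Proof.
move=> s_inj F0; exists (\max_(0 <= k < N) (s k).+1).
rewrite -(big_map s predT); set r := map _ _; set M := (\max_(_ <= _ < _) _)%N.
have -> : \sum_(i <- r) F i = \sum_(0 <= k < M | k \in r) F k.
  rewrite -[RHS]big_filter; apply: perm_big; apply: uniq_perm.
  - by rewrite map_inj_uniq ?iota_uniq.
  - by rewrite filter_uniq ?iota_uniq.
  move=> n; rewrite mem_filter mem_index_iota leq0n /=.
  rewrite andb_idr// => /mapP[k]; rewrite mem_index_iota => /andP[_ kN] ->.
  by rewrite /M -/(index_iota 0 N) (bigD1_seq k) ?iota_uniq ?mem_index_iota//= leq_max leqnn.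
by rewrite big_mkcond/=; apply: ler_sum => n _; case: ifP.
Qed.

(** List the interval with the indices satisfying [p] first: [f] reads the list, [g] looks an index
    up in it, and both are the identity outside. A subset sum thus becomes a sum over an initial
    segment. *)
Lemma gather_block (V : nmodType) (a b : nat) (p : pred nat) :
  exists f g : nat -> nat,
    [/\ cancel f g, cancel g f,
        forall n, (a <= f n < b)%N = (a <= n < b)%N,
        forall n, (a <= g n < b)%N = (a <= n < b)%N &
        forall F : nat -> V,
          \sum_(a <= n < a + count p (index_iota a b)) F (f n) =
          \sum_(a <= n < b | p n) F n].
Proof.
pose l := seq.filter p (index_iota a b) ++ seq.filter (predC p) (index_iota a b).
have l_perm : perm_eq l (index_iota a b) by rewrite perm_filterC.
have l_uniq : uniq l by rewrite (perm_uniq l_perm) iota_uniq.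
have l_mem n : (n \in l) = (a <= n < b)%N by rewrite (perm_mem l_perm) mem_index_iota.
have l_size : size l = (b - a)%N by rewrite (perm_size l_perm) size_iota.
pose f n := if (a <= n < b)%N then nth 0%N l (n - a) else n.
pose g n := if (a <= n < b)%N then (a + index n l)%N else n.
have ltl n : (a <= n < b)%N -> (n - a < size l)%N.
  by rewrite l_size => /andP[an nb]; rewrite ltn_sub2r// (leq_ltn_trans an).
have fP n : (a <= f n < b)%N = (a <= n < b)%N.
  by rewrite /f; case: ifP => // h; rewrite -l_mem mem_nth ?ltl.
have gP n : (a <= g n < b)%N = (a <= n < b)%N.
  rewrite /g; case: ifP => // h; rewrite leq_addr/= -ltn_subRL -l_size.
  by rewrite index_mem l_mem.
exists f, g; split=> //.
- move=> n; rewrite {1}/g fP; case: ifPn => [h|/negbTE h]; rewrite /f h//.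
  by rewrite index_uniq ?ltl// subnKC//; case/andP: h.
- move=> n; rewrite {1}/f gP; case: ifPn => [h|/negbTE h]; rewrite /g h//.
  by rewrite addKn nth_index// l_mem.
move=> F; rewrite -[RHS]big_filter; set q := seq.filter p _.
have szq : count p (index_iota a b) = size q by rewrite size_filter.
have leq_q : (size q <= b - a)%N by rewrite -l_size size_cat leq_addr.
rewrite szq (big_nth 0%N) -{1}[a in LHS]add0n [(a + size q)%N]addnC big_addn addnK.
apply: eq_big_nat => i /andP[_ iq]; congr F.
have ib : (a <= i + a < b)%N.
  by rewrite leq_addl/= addnC -ltn_subRL (leq_trans iq).
by rewrite /f ib addnK nth_cat iq.
Qed.

End Rearrangement.

(** * Bounded subset sums of unconditionally convergent series *)

Section SubsetSums.
Variables (R : realType) (V : completeNormedModType R[i]).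

(** The blocks [[N k, N k.+1)] partition the indices and gathering maps each onto itself, so the
    gatherings of all blocks glue to one permutation. *)
Lemma rearrange_blocks (x : nat -> V) (N : nat -> nat) (p : nat -> pred nat) :
  N 0%N = 0%N -> (forall k, (N k < N k.+1)%N) ->
  exists2 s : nat -> nat, bijective s &
    forall k, exists2 c, (c >= N k)%N &
      \sum_(N k <= n < c) x (s n) = \sum_(N k <= n < N k.+1 | p k n) x n.
Proof.
move=> N0 Nlt.
have Nmono : {homo N : i j / (i <= j)%N}.
  by apply: homo_leq => [//|j i k|k]; [exact: leq_trans|exact: ltnW].
have blockE n : exists k, (N k <= n < N k.+1)%N.
  elim: n => [|n [k /andP[kn nk]]]; first by exists 0%N; rewrite N0 (leq_ltn_trans _ (Nlt 0%N)).
  have [h|h] := ltnP n.+1 (N k.+1); first by exists k; rewrite h (leq_trans kn).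
  by exists k.+1; rewrite h (leq_ltn_trans nk).
have block_uniq n i j : (N i <= n < N i.+1)%N -> (N j <= n < N j.+1)%N -> i = j.
  suff W i' j' : (N i' <= n < N i'.+1)%N -> (N j' <= n < N j'.+1)%N -> (i' <= j')%N.
    by move=> hi hj; apply/eqP; rewrite eqn_leq (W _ _ hi hj) (W _ _ hj hi).
  move=> /andP[h1 _] /andP[_ h2]; rewrite leqNgt; apply/negP => /Nmono h3.
  by have := leq_trans h2 (leq_trans h3 h1); rewrite ltnn.
have /choice[blk blkP] := blockE.
have /choice[f /choice[g fgP]] := fun k => gather_block V (N k) (N k.+1) (p k).
exists (fun n => f (blk n) n).
  exists (fun n => g (blk n) n) => n.
    have [fK gK fP gP _] := fgP (blk n).
    have -> : blk (f (blk n) n) = blk n.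
      by apply: (@block_uniq (f (blk n) n)) => //; rewrite fP.
    exact: fK.
  have [fK gK fP gP _] := fgP (blk n).
  have -> : blk (g (blk n) n) = blk n.
    by apply: (@block_uniq (g (blk n) n)) => //; rewrite gP.
  exact: gK.
move=> k; have [_ _ _ _ sumE] := fgP k.
eexists; last first.
  rewrite -sumE; apply: eq_big_nat => n /andP[kn nc].
  suff -> : blk n = k by [].
  apply: (@block_uniq n) => //; rewrite kn/=.
  apply: leq_trans nc _; rewrite -leq_subRL; last exact: ltnW.
  by rewrite (leq_trans (count_size _ _))// size_iota.
exact: leq_addr.
Qed.

(** Otherwise, past every index there is a block with a subset sum of norm above 1. Gathering these
    subsets yields a rearrangement whose partial sums are not Cauchy. *)
Lemma subset_sums_bounded (x : nat -> V) :
  (forall s : nat -> nat, bijective s -> cvgn (series (x \o s))) ->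
  exists C : R, forall N (p : pred nat), rnorm (\sum_(0 <= n < N | p n) x n) <= C.
Proof.
move=> xs; apply: contrapT => /forallNP unbounded.
have step a : exists bp : nat * pred nat,
    (a < bp.1)%N /\ 1 < rnorm (\sum_(a <= n < bp.1 | bp.2 n) x n).
  apply: contrapT => /forallNP nostep.
  (* If all subset sums starting at [a] had norm at most 1, this constant would bound every subset
     sum: split it at [a]. *)
  apply: (unbounded (1 + \sum_(0 <= n < a) rnorm (x n))) => N p.
  have ler_part k : rnorm (\sum_(0 <= n < k | p n) x n) <= \sum_(0 <= n < k) rnorm (x n).
    rewrite (le_trans (rnorm_sum _ _ _))// big_mkcond/=.
    by apply: ler_sum => n _; case: ifP => // _; exact: rnorm_ge0.
  have [aN|Na] := ltnP a N.
    rewrite (@big_cat_nat _ _ _ a)//=; last exact: ltnW.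
    rewrite (le_trans (rnormD _ _))// addrC lerD//.
    by rewrite leNgt; apply/negP => h; apply: (nostep (N, p)).
  rewrite (le_trans (ler_part _))// [leRHS]addrC -[leLHS]addr0 lerD//.
  rewrite [leRHS](@big_cat_nat _ _ _ N)//= lerDl.
  by apply: sumr_ge0 => n _; exact: rnorm_ge0.
have /choice[bp bpP] := step.
pose N k := iter k (fun a => (bp a).1) 0%N.
have [||s s_bij sP] := @rearrange_blocks x N (fun k => (bp (N k)).2) => //.
  by move=> k; have [] := bpP (N k).
have /cvgn_rnormP := xs s s_bij; set l := limn _ => xl.
(* Past [K] two partial sums differ by less than 1, whereas the gathered subset of block [K], which
   starts at [N K >= K], sums to norm above 1. *)
have [K hK] : exists K, forall n, (K <= n)%N -> rnorm (l - series (x \o s) n) < 1 / 2.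
  by apply: xl; rewrite divr_gt0.
have geN k : (k <= N k)%N.
  by elim: k => // k ih; apply: leq_ltn_trans ih _; have [] := bpP (N k).
have [c Nc sumE] := sP K; have [_] := bpP (N K).
rewrite -/(N K.+1) -sumE -(sub_series_geq (x \o s) Nc) => big_sum.
have h1 := hK _ (geN K); have h2 := hK _ (leq_trans (geN K) Nc).
have := rnormD (series (x \o s) c - l) (l - series (x \o s) (N K)).
rewrite addrA subrK (rnormB _ l); lra.
Qed.

End SubsetSums.

(* The library proves the Banach-Steinhaus theorem only over real scalars.  Were
   the seminorms unbounded, every ball would contain a smaller ball on which one
   of them exceeds a given n; a common point of nested such balls contradicts
   pointwise boundedness. *)
Section UniformBoundedness.
Variables (R : realType) (V : completeNormedModType R[i]).

Lemma nested_balls (x : nat -> V) (r : nat -> R) :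
  (forall n, 0 < r n) -> (forall n, r n.+1 <= r n / 2) ->
  (forall n, rnorm (x n.+1 - x n) <= r n / 2) ->
  exists l, forall n, rnorm (l - x n) <= r n.
Proof.
move=> r0 rS xS.
(* This says that the ball with index [n + k] lies inside the ball with index [n]. *)
have dist n k : rnorm (x (n + k)%N - x n) + r (n + k)%N <= r n.
  elim: k => [|k]; first by rewrite addn0 subrr rnorm0 add0r.
  have := rnormD (x (n + k).+1 - x (n + k)%N) (x (n + k)%N - x n).
  rewrite addrA subrK addnS.
  have := xS (n + k)%N; have := rS (n + k)%N; lra.
(* The radii decay geometrically; this weaker harmonic rate is enough to choose [N] below. *)
have rle n : r n * n.+1%:R <= r 0%N.
  elim: n => [|n ih]; first by rewrite mulr1.
  have h := rS n; have := r0 n; rewrite -(natr1 n.+1) -(natr1 n) in ih * => rn.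
  have n0 : 0 <= n%:R :> R by [].
  have := r0 n.+1; nra.
have dist_lt n k : (n <= k)%N -> rnorm (x k - x n) <= r n.
  move=> /subnKC <-; have := dist n (k - n)%N; have := r0 (n + (k - n))%N; lra.
have : cvgn x.
  apply: cvgn_cauchy_rnorm => eps e0.
  pose N := Num.truncn (2 * r 0%N / eps); exists N.
  have rN : r N < eps / 2.
    have h := truncnS_gt (2 * r 0%N / eps); rewrite -/N ltr_pdivrMr// in h.
    have := rle N; have := r0 N; have : 0 < N.+1%:R :> R by []. nra.
  move=> m n /dist_lt hm /dist_lt hn.
  have := rnormD (x m - x N) (x N - x n); rewrite addrA subrK (rnormB (x N)); lra.
move=> /cvgn_rnormP xl; exists (limn x) => n.
apply/ler_addgt0Pr => eps /xl[N hN].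
have := hN _ (leq_maxl N n); have := dist_lt _ _ (leq_maxr N n).
have := rnormD (limn x - x (maxn N n)) (x (maxn N n) - x n); rewrite addrA subrK; lra.
Qed.

Lemma uniform_boundedness (I : Type) (p : I -> V -> R) :
  (forall i x y, p i (x + y) <= p i x + p i y) ->
  (forall i a x, p i (a *: x) = rnorm a * p i x) ->
  (forall i, exists L, forall x, p i x <= L * rnorm x) ->
  (forall x, exists C, forall i, p i x <= C) ->
  exists2 C, 0 <= C & forall i x, p i x <= C * rnorm x.
Proof.
move=> pD pZ p_bounded p_pointwise; apply: contrapT => unbounded.
have p0 i : p i 0 = 0 by rewrite -(scale0r 0) pZ rnorm0 mul0r.
have pN i x : p i (- x) = p i x.
  by rewrite -scaleN1r pZ rnormN rnorm1 mul1r.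
have p_ge0 i x : 0 <= p i x by have := pD i x (- x); rewrite subrr p0 pN; lra.
(* The positivity premise sits under the existential so that the choice function is total; for a
   nonpositive radius any pair serves. *)
have step n (xr : V * R) : exists ys : V * R, 0 < xr.2 ->
    [/\ 0 < ys.2, ys.2 <= xr.2 / 2, rnorm (ys.1 - xr.1) <= xr.2 / 2 &
        exists i, forall z, rnorm (z - ys.1) <= ys.2 -> n%:R < p i z].
  case: xr => x r /=; have [r0|r0] := ltP 0 r; last by exists (x, r) => /=; lra.
  have [i [y xy ny]] : exists i, exists2 y, rnorm (y - x) <= r / 2 & n%:R < p i y.
    apply: contrapT => /forallNP no; apply: unbounded.
    have small i y : rnorm (y - x) <= r / 2 -> p i y <= n%:R.
      by move=> xy; rewrite leNgt; apply/negP => ny; apply: (no i); exists y.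
    (* If every [p i] is at most [n] on the ball of radius [r / 2] about [x], subtracting its points
       [x + t h] and [x] with [t = r / (2 |h|)] gives [t * p i h <= 2 n]. *)
    exists (4 * n%:R / r) => [|i h]; first by rewrite divr_ge0 ?mulr_ge0// ltW.
    have [->|h0] := eqVneq h 0; first by rewrite p0 rnorm0 mulr0.
    have h_gt0 : 0 < rnorm h by rewrite lt_def rnorm_ge0 rnorm_eq0 h0.
    pose t := r / (2 * rnorm h).
    have t0 : 0 < t by rewrite divr_gt0 ?mulr_gt0.
    have := pD i (x + t%:C%C *: h) (- x).
    rewrite addrC addKr pZ pN rnorm_real gtr0_norm//.
    have : p i (x + t%:C%C *: h) <= n%:R.
      apply: small; rewrite [x + _]addrC addrK rnormZ rnorm_real gtr0_norm// /t.
      by rewrite invfM mulrA mulfVK// gt_eqF.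
    have : p i x <= n%:R by apply: small; rewrite subrr rnorm0 divr_ge0// ltW.
    move=> h1 h2 h3.
    have {h3} : t * p i h <= 2 * n%:R by lra.
    rewrite mulrC -ler_pdivlMr// => h3; apply: le_trans h3 _.
    rewrite le_eqVlt; apply/orP; left; apply/eqP; rewrite /t; field.
    by rewrite !gt_eqF.
  have [L Lp] := p_bounded i.
  (* Within distance [s] of [y] the seminorm drops by at most half its excess over [n], since [L] is
     a Lipschitz constant; the added 1 keeps the denominator positive. *)
  pose s := Num.min (r / 2) ((p i y - n%:R) / (2 * (`|L| + 1))).
  have L0 : 0 <= `|L| by [].
  exists (y, s) => /= _; split=> //.
  - by rewrite lt_min !divr_gt0//=; lra.
  - by rewrite ge_min lexx.
  exists i => z zy.
  have h1 := pD i z (y - z); rewrite addrC subrK in h1.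
  have h2 := Lp (y - z); rewrite rnormB in h2.
  have h3 : s * (2 * (`|L| + 1)) <= p i y - n%:R.
    by rewrite -ler_pdivlMr ?ge_min ?lexx ?orbT//; lra.
  have h4 := ler_norm L; have h5 := rnorm_ge0 (z - y).
  have h6 : L * rnorm (z - y) <= `|L| * rnorm (z - y) by apply: ler_wpM2r.
  have h7 : `|L| * rnorm (z - y) <= `|L| * s by apply: ler_wpM2l.
  have h8 : 0 <= `|L| * s by apply: mulr_ge0 => //; exact: le_trans h5 zy.
  have : n%:R < p i y by [].
  nra.
have /choice[G GP] := fun nxr : nat * (V * R) => step nxr.1 nxr.2.
pose u := fix u n := if n is k.+1 then G (k, u k) else (0, 1).
have u0 n : 0 < (u n).2.
  by elim: n => [|n ih] /=; [exact: ltr01 | have [] := GP (n, u n) ih].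
have uP n := GP (n, u n) (u0 n).
have [|||l lu] := @nested_balls (fun n => (u n).1) (fun n => (u n).2) => //.
- by move=> n; have [] := uP n.
- by move=> n; have [] := uP n.
have [C CP] := p_pointwise l.
(* The common point [l] lies in ball [n.+1], on which some [p i] exceeds [n > C]. *)
pose n := (Num.truncn C).+1.
have [_ _ _ [i /(_ l (lu n.+1))]] := uP n.
have := CP i; have := truncnS_gt C; rewrite -/n /=; lra.
Qed.

End UniformBoundedness.

(** Termwise this is [(t u - v)^2 >= 0] divided by [t]. The free weight [t] lets one of the two sums
    be absorbed later. *)
Lemma weighted_sum_mul_le (R : realFieldType) (t : R) (u v : nat -> R) i j : 0 < t ->
  \sum_(i <= n < j) u n * v n <=
    (t * (\sum_(i <= n < j) u n ^+ 2) + t^-1 * (\sum_(i <= n < j) v n ^+ 2)) / 2.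
Proof.
move=> t0; rewrite !mulr_sumr -big_split/= mulr_suml; apply: ler_sum => n _.
rewrite ler_pdivlMr// -subr_ge0.
have -> : t * u n ^+ 2 + t^-1 * v n ^+ 2 - u n * v n * 2 = t^-1 * (t * u n - v n) ^+ 2.
  by field; rewrite gt_eqF.
by rewrite mulr_ge0 ?sqr_ge0// invr_ge0 ltW.
Qed.

(** * Bessel sequences and frames *)

Section BesselSequences.
Variables (R : realType) (H : completeNormedModType R[i]).
Variable dot : {dot H for (@Num.conj R[i])}.
Hypothesis dot_norm : induces_norm dot.
Implicit Types (m : nat -> R[i]) (phi psi : nat -> H).

(** Bounding the finite partial sums is equivalent to bounding the series of nonnegative terms, and
    stays within the reals. *)
Definition bessel (B : R) phi := forall (h : H) N,
  \sum_(0 <= n < N) rnorm (dot h (phi n)) ^+ 2 <= B * rnorm h ^+ 2.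

Lemma frame_bessel phi : frame dot phi -> exists2 B, 0 < B & bessel B phi.
Proof.
case=> A [B [A0 AB AB_frame]]; exists B => [|h N]; first exact: lt_le_trans AB.
have /andP[_ hB] := AB_frame h; rewrite -lee_fin; apply: le_trans hB.
by rewrite -sumEFin; apply: nneseries_lim_ge => n _ _; rewrite lee_fin exprn_ge0 ?rnorm_ge0.
Qed.

(** The series is the least upper bound of its partial sums, so its lower bound may be checked
    against every real upper bound [s] of them. *)
Lemma bessel_frame A B phi : 0 < A -> bessel B phi ->
  (forall h s, (forall N, \sum_(0 <= n < N) rnorm (dot h (phi n)) ^+ 2 <= s) ->
    A * rnorm h ^+ 2 <= s) ->
  frame dot phi.
Proof.
move=> A0 phiB lower; exists A, (Num.max A B); split=> // [|h].
  by rewrite le_max lexx.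
set S := limn _.
have term_ge0 n : (0 <= n)%N -> xpredT n -> (0%:E <= (rnorm (dot h (phi n)) ^+ 2)%:E)%E.
  by move=> _ _; rewrite lee_fin exprn_ge0 ?rnorm_ge0.
have SB : (S <= (B * rnorm h ^+ 2)%:E)%E.
  apply: lime_le; first exact: is_cvg_nneseries.
  by apply: nearW => N; rewrite sumEFin lee_fin.
have S0 : (0%:E <= S)%E by exact: nneseries_ge0.
have Sfin : S \is a fin_num.
  by rewrite ge0_fin_numE//; apply: le_lt_trans SB _; rewrite ltry.
apply/andP; split.
  rewrite -(fineK Sfin) lee_fin; apply: lower => N.
  by rewrite -lee_fin fineK// -sumEFin; exact: nneseries_lim_ge.
apply: le_trans SB _; rewrite lee_fin ler_wpM2r ?exprn_ge0 ?rnorm_ge0//.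
by rewrite le_max lexx orbT.
Qed.

Lemma bessel_comp B phi (s : nat -> nat) : injective s -> bessel B phi ->
  bessel B (phi \o s).
Proof.
move=> s_inj phiB h N.
have [M le_M] := @ler_sum_injective R (fun n => rnorm (dot h (phi n)) ^+ 2) s N s_inj
  (fun n => exprn_ge0 _ (rnorm_ge0 _)).
exact: le_trans le_M (phiB h M).
Qed.

(** Duality: with [y] the sum, [|y|^2] is the sum of [a_n <phi_n, y>]. The weighted inequality with
    [t = B] and the Bessel bound at [y] itself leave [|y|^2 / 2] on the right, which is absorbed. *)
Lemma bessel_synthesis B phi (a : nat -> R[i]) (i j : nat) : 0 < B -> bessel B phi ->
  rnorm (\sum_(i <= n < j) a n *: phi n) ^+ 2 <=
    B * \sum_(i <= n < j) rnorm (a n) ^+ 2.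
Proof.
move=> B0 phiB; set y := \sum_(i <= n < j) _.
have yphi : \sum_(i <= n < j) rnorm (dot y (phi n)) ^+ 2 <= B * rnorm y ^+ 2.
  apply: le_trans (phiB y j); have [ij|/ltnW ji] := leqP i j; last first.
    by rewrite big_geq// sumr_ge0// => n _; rewrite exprn_ge0 ?rnorm_ge0.
  rewrite [leRHS](@big_cat_nat _ _ _ i)//= lerDr sumr_ge0// => n _.
  by rewrite exprn_ge0 ?rnorm_ge0.
have : rnorm y ^+ 2 <= \sum_(i <= n < j) rnorm (a n) * rnorm (dot y (phi n)).
  rewrite -[leLHS]ger0_norm ?exprn_ge0 ?rnorm_ge0// -rnorm_real -(dotxx dot_norm) {1}/y.
  rewrite (dot_suml dot); apply: le_trans (rnorm_sum _ _ _) _.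
  by apply: ler_sum => n _; rewrite (dotZl dot) rnormM (rnorm_dotC dot).
have := weighted_sum_mul_le (fun n => rnorm (a n)) (fun n => rnorm (dot y (phi n))) i j B0.
rewrite -(ler_pM2l (_ : 0 < B^-1)) ?invr_gt0// mulrA mulVf ?gt_eqF// mul1r in yphi.
lra.
Qed.

Lemma bessel_cvg B B' phi psi f : 0 < B -> bessel B phi -> bessel B' psi ->
  cvgn (series (fun n => dot f (psi n) *: phi n)).
Proof.
move=> B0 phiB psiB'.
have /cauchy_cvgP/cauchy_seriesP sq_cauchy :
    cvgn (series (fun n => rnorm (dot f (psi n)) ^+ 2)).
  apply: nondecreasing_is_cvgn.
    apply/nondecreasing_seqP => n; rewrite !seriesEnat/= big_nat_recr//= lerDl.
    by rewrite exprn_ge0 ?rnorm_ge0.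
  by exists (B' * rnorm f ^+ 2) => _ [N _ <-]; rewrite seriesEnat; exact: psiB'.
apply/cauchy_cvgP/cauchy_seriesP.
apply/(pos_complexP (fun e => \forall n \near (\oo, \oo),
  `|\sum_(n.1 <= k < n.2) (dot f (psi k) *: phi k)| < e)) => eps e0.
have := sq_cauchy (eps ^+ 2 / B) (divr_gt0 (exprn_gt0 2 e0) B0).
apply: filterS => -[i j] /=; rewrite ger0_norm ?sumr_ge0// => [h|n _]; last first.
  by rewrite exprn_ge0 ?rnorm_ge0.
rewrite rnormE ltcR -(ltr_pXn2r (_ : 0 < 2)%N) ?nnegrE ?rnorm_ge0 ?(ltW e0)//.
apply: le_lt_trans (bessel_synthesis _ _ _ B0 phiB) _.
by rewrite mulrC -ltr_pdivlMr.
Qed.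

Lemma cvg_rnorm_le (u : nat -> H) (l : H) (C : R) :
  u @ \oo --> l -> (forall n, rnorm (u n) <= C) -> rnorm l <= C.
Proof.
move=> /cvgn_rnormP ul uC; apply/ler_addgt0Pr => eps /ul[N /(_ _ (leqnn N))].
by have := rnormD (l - u N) (u N); have := uC N; rewrite subrK; lra.
Qed.

Lemma cvg_dot_le (u : nat -> H) (l g : H) (C : R) :
  u @ \oo --> l -> (forall n, rnorm (dot (u n) g) <= C) -> rnorm (dot l g) <= C.
Proof.
move=> /cvgn_rnormP ul uC; apply/ler_addgt0Pr => eps e0.
have [N /(_ _ (leqnn N)) h] := ul _ (divr_gt0 e0 (ltr_wpDl (rnorm_ge0 g) ltr01)).
have : rnorm (l - u N) * rnorm g <= eps.
  have : rnorm (l - u N) * (rnorm g + 1) < eps.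
    by rewrite -ltr_pdivlMr//; have := rnorm_ge0 g; lra.
  by have := rnorm_ge0 (l - u N); lra.
have := cauchy_schwarz dot_norm (l - u N) g.
have := rnormD (dot (l - u N) g) (dot (u N) g); rewrite -(dotDl dot) subrK.
have := uC N; lra.
Qed.

(** For [phi], pair [g = M (T g)] with [g] and bound the coefficients of [T g] by the Bessel
    property of [psi]. For [psi], use [|f| = |T (M f)| <= C |M f|] and the synthesis bound on
    [M f]. *)
Lemma bessel_invertible_frames B B' phi psi (M T : H -> H) :
  0 < B -> 0 < B' -> bessel B phi -> bessel B' psi ->
  (forall f, series (fun n => dot f (psi n) *: phi n) @ \oo --> M f) ->
  bounded_operator T -> (forall f, M (T f) = f) -> (forall f, T (M f) = f) ->
  frame dot phi /\ frame dot psi.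
Proof.
move=> B0 B'0 phiB psiB' ML [C0 TC0] MT TM.
pose C := `|C0| + 1; have C_gt0 : 0 < C by rewrite ltr_wpDl.
have TC x : rnorm (T x) <= C * rnorm x.
  apply: le_trans (TC0 x) _; rewrite ler_wpM2r ?rnorm_ge0//.
  by rewrite (le_trans (ler_norm _))// lerDl.
split.
  apply: (@bessel_frame (B' * C ^+ 2)^-1 B) => // [|g s gs].
    by rewrite invr_gt0 mulr_gt0 ?exprn_gt0.
  (* With this weight the coefficients of [T g] contribute at most [|g|^2 / 2], which is absorbed on
     the left. *)
  pose t := (B' * C ^+ 2)^-1; have t0 : 0 < t by rewrite invr_gt0 mulr_gt0 ?exprn_gt0.
  have : rnorm (dot g g) <= (rnorm g ^+ 2 + t^-1 * s) / 2.
    rewrite -{1}(MT g); apply: cvg_dot_le (ML (T g)) _ => N.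
    rewrite seriesEnat/= (dot_suml dot); apply: le_trans (rnorm_sum _ _ _) _.
    have TgB : t * \sum_(0 <= n < N) rnorm (dot (T g) (psi n)) ^+ 2 <= rnorm g ^+ 2.
      rewrite -ler_pdivlMl// /t invrK; apply: le_trans (psiB' _ N) _.
      rewrite -mulrA ler_pM2l// -exprMn ler_sqr ?nnegrE ?mulr_ge0 ?rnorm_ge0//.
      exact: ltW.
    apply: (@le_trans _ _ ((t * (\sum_(0 <= n < N) rnorm (dot (T g) (psi n)) ^+ 2) +
      t^-1 * \sum_(0 <= n < N) rnorm (dot g (phi n)) ^+ 2) / 2)); last first.
      by rewrite ler_pM2r ?invr_gt0// lerD// ler_pM2l ?(invr_gt0 t).
    apply: le_trans (weighted_sum_mul_le _ _ _ _ t0).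
    by apply: ler_sum => n _; rewrite (dotZl dot) rnormM (rnorm_dotC dot (phi n)).
  rewrite (dotxx dot_norm) rnorm_real ger0_norm ?exprn_ge0 ?rnorm_ge0//.
  by move=> h; rewrite -/t -ler_pdivlMl//; lra.
apply: (@bessel_frame (B * C ^+ 2)^-1 B') => // [|f s fs].
  by rewrite invr_gt0 mulr_gt0 ?exprn_gt0.
have s0 : 0 <= s by have := fs 0%N; rewrite big_geq.
have Bs0 : 0 <= B * s by rewrite mulr_ge0// ltW.
have Mfs : rnorm (M f) <= Num.sqrt (B * s).
  apply: cvg_rnorm_le (ML f) _ => N.
  rewrite -[leLHS]ger0_norm ?rnorm_ge0// -sqrtr_sqr ler_sqrt//.
  rewrite seriesEnat; apply: le_trans; first exact: (bessel_synthesis _ _ _ B0 phiB).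
  by rewrite ler_pM2l.
have {Mfs} Mfs : rnorm (M f) ^+ 2 <= B * s.
  by rewrite -(sqr_sqrtr Bs0) ler_sqr ?nnegrE ?rnorm_ge0 ?sqrtr_ge0.
rewrite ler_pdivrMl ?mulr_gt0 ?exprn_gt0//.
rewrite -{1}(TM f); apply: (@le_trans _ _ ((C * rnorm (M f)) ^+ 2)).
  by rewrite ler_sqr ?nnegrE ?mulr_ge0 ?rnorm_ge0// ltW.
by rewrite exprMn (mulrC B) -[leRHS]mulrA ler_pM2l ?exprn_gt0//.
Qed.

(** Pairing the expansion of [f] with [f] turns its partial sums into sums of squared coefficients,
    so both frame bounds can be taken to be 1. *)
Lemma resolution_frame phi :
  (forall f, series (fun n => dot f (phi n) *: phi n) @ \oo --> f) -> frame dot phi.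
Proof.
move=> res.
have dotS f N : dot (series (fun n => dot f (phi n) *: phi n) N) f =
    (\sum_(0 <= n < N) rnorm (dot f (phi n)) ^+ 2)%:C%C.
  rewrite seriesEnat/= (dot_suml dot) rmorph_sum; apply: eq_bigr => n _.
  by rewrite /= (dotZl dot) -conj_mulr_norm (dotC dot (phi n)).
have S0 f N : 0 <= \sum_(0 <= n < N) rnorm (dot f (phi n)) ^+ 2.
  by rewrite sumr_ge0// => n _; rewrite exprn_ge0 ?rnorm_ge0.
have normS f N : rnorm (dot (series (fun n => dot f (phi n) *: phi n) N) f) =
    \sum_(0 <= n < N) rnorm (dot f (phi n)) ^+ 2.
  by rewrite dotS rnorm_real ger0_norm.
apply: (@bessel_frame 1 1) => // [h N|h s hs]; rewrite mul1r; last first.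
  rewrite -[leLHS]ger0_norm ?exprn_ge0 ?rnorm_ge0// -rnorm_real -(dotxx dot_norm).
  by apply: cvg_dot_le (res h) _ => N; rewrite normS.
apply/ler_addgt0Pr => eps e0.
have /cvgn_rnormP/(_ _ (divr_gt0 e0 (ltr_wpDl (rnorm_ge0 h) ltr01)))[K hK] := res h.
(* The sums of squares increase, so [N] may be enlarged until the partial expansion is close to
   [h]. *)
pose k := maxn K N; have {}hK := hK k (leq_maxl _ _).
have : \sum_(0 <= n < N) rnorm (dot h (phi n)) ^+ 2 <=
    \sum_(0 <= n < k) rnorm (dot h (phi n)) ^+ 2.
  rewrite [leRHS](@big_cat_nat _ _ _ N) ?leq_maxr//= lerDl sumr_ge0// => n _.
  by rewrite exprn_ge0 ?rnorm_ge0.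
move=> /le_trans; apply; rewrite -normS.
have := rnormD (dot (series (fun n => dot h (phi n) *: phi n) k - h) h) (dot h h).
rewrite -(dotDl dot) subrK (dotxx dot_norm h) rnorm_real ger0_norm ?exprn_ge0 ?rnorm_ge0//.
have := cauchy_schwarz dot_norm (series (fun n => dot h (phi n) *: phi n) k - h) h.
rewrite rnormB; rewrite ltr_pdivlMr in hK; last by have := rnorm_ge0 h; lra.
have := rnorm_ge0 (h - series (fun n => dot h (phi n) *: phi n) k); lra.
Qed.

End BesselSequences.

(** * From unconditional convergence to Bessel bounds *)

Section UnconditionalConvergence.
Variables (R : realType) (H : completeNormedModType R[i]).
Variable dot : {dot H for (@Num.conj R[i])}.
Hypothesis dot_norm : induces_norm dot.
Implicit Types (m : nat -> R[i]) (phi psi : nat -> H).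

Lemma exists_signs (x : nat -> H) N : exists b : nat -> bool,
  \sum_(0 <= n < N) rnorm (x n) ^+ 2 <=
    rnorm (\sum_(0 <= n < N) (-1 : R[i]) ^+ b n *: x n) ^+ 2.
Proof.
elim: N => [|N [b hb]].
  by exists xpredT; rewrite !big_geq// rnorm0 expr0n.
set y := \sum_(0 <= n < N) _ *: _ in hb.
(* The new sign makes the cross term in [|y +- x_N|^2] nonnegative; earlier signs are kept. *)
pose b' n := if n == N then complex.Re (dot y (x N)) < 0 else b n.
exists b'; rewrite !big_nat_recr//=.
have -> : \sum_(0 <= n < N) (-1 : R[i]) ^+ b' n *: x n = y.
  by apply: eq_big_nat => n /andP[_ nN]; rewrite /b' ltn_eqF.
have b'N : b' N = (complex.Re (dot y (x N)) < 0) by rewrite /b' eqxx.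
suff h : rnorm y ^+ 2 + rnorm (x N) ^+ 2 <= rnorm (y + (-1 : R[i]) ^+ b' N *: x N) ^+ 2.
  by apply: le_trans h; rewrite lerD2r.
have normD z : rnorm (y + z) ^+ 2 =
    rnorm y ^+ 2 + rnorm z ^+ 2 + 2 * complex.Re (dot y z).
  have := dotxx dot_norm (y + z).
  rewrite linearDl/= !linearDr/= !(dotxx dot_norm) (dotC dot z y).
  move=> /(congr1 (@complex.Re R)) /= <-.
  by case: (dot y z) => u v /=; ring.
rewrite b'N normD; case: ltP => h /=.
  by rewrite expr1 scaleN1r rnormN linearNr/=; move: h; case: (dot y (x N)) => u v /=; lra.
by rewrite expr0 scale1r; lra.
Qed.

(** Uniform boundedness applies to the seminorms given by the signed partial sums, indexed by length
    and signs. They are pointwise bounded because a signed sum is the difference of two subset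
    sums. *)
Lemma unconditional_signed_bound m phi psi :
  unconditionally_convergent dot m phi psi ->
  exists2 C : R, 0 <= C & forall N (b : nat -> bool) f,
    rnorm (\sum_(0 <= n < N) (-1 : R[i]) ^+ b n *: multiplier_term dot m phi psi f n)
      <= C * rnorm f.
Proof.
move=> unc; pose t := multiplier_term dot m phi psi.
have tD f g n : t (f + g) n = t f n + t g n.
  by rewrite /t /multiplier_term (dotDl dot) mulrDr scalerDl.
have tZ a f n : t (a *: f) n = a *: t f n.
  by rewrite /t /multiplier_term (dotZl dot) mulrCA scalerA.
pose S (i : nat * (nat -> bool)) f :=
  \sum_(0 <= n < i.1) (-1 : R[i]) ^+ i.2 n *: t f n.
have rnorm_sign (b : bool) (x : H) : rnorm ((-1 : R[i]) ^+ b *: x) = rnorm x.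
  by rewrite rnormZ /rnorm normrX normrN1 expr1n mul1r.
have [||||C C0 CP] := @uniform_boundedness R H _ (fun i f => rnorm (S i f)).
- move=> i f g; apply: le_trans (rnormD _ _); rewrite le_eqVlt; apply/orP; left.
  apply/eqP; congr rnorm; rewrite /S -big_split/=; apply: eq_bigr => n _.
  by rewrite tD scalerDr.
- move=> i a f; rewrite -rnormZ /S scaler_sumr; congr rnorm; apply: eq_bigr => n _.
  by rewrite tZ scalerA mulrC -scalerA.
- move=> [N b]; exists (\sum_(0 <= n < N) rnorm (m n) * rnorm (psi n) * rnorm (phi n)).
  move=> f; apply: le_trans (rnorm_sum _ _ _) _.
  rewrite mulr_suml; apply: ler_sum => n _; rewrite rnorm_sign rnormZ rnormM.
  have -> : rnorm (m n) * rnorm (psi n) * rnorm (phi n) * rnorm f =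
    rnorm (m n) * rnorm (phi n) * (rnorm f * rnorm (psi n)) by ring.
  rewrite mulrAC.
  by rewrite ler_wpM2l ?mulr_ge0 ?rnorm_ge0//; exact: cauchy_schwarz.
- move=> f; have [C CP] := subset_sums_bounded (unc f); exists (C + C) => -[N b].
  have -> : S (N, b) f = \sum_(0 <= n < N | ~~ b n) t f n - \sum_(0 <= n < N | b n) t f n.
    rewrite /S (bigID b)/= addrC; congr (_ + _).
      by apply: eq_bigr => n /negbTE ->; rewrite scale1r.
    rewrite -sumrN; apply: eq_bigr => n ->; by rewrite expr1 scaleN1r.
  apply: le_trans (rnormD _ _) _; rewrite rnormN; apply: lerD.
    exact: (CP N (fun n => ~~ b n)).
  exact: (CP N b).
by exists C => // N b f; exact: (CP (N, b)).
Qed.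

(** The coefficients of [f] against the second sequence have the moduli of the multiplier terms at
    [f]; those against the first have the moduli of the formal adjoint's terms. Well-chosen signs
    bound both sums of squares. *)
Lemma unconditional_bessel m phi psi : unconditionally_convergent dot m phi psi ->
  exists2 B : R, 0 < B &
    bessel dot B (fun n => (m n * `|psi n|) *: phi n) /\
    bessel dot B (fun n => (Num.conj (m n) * `|phi n|) *: psi n).
Proof.
move=> /unconditional_signed_bound[C C0 CP].
have C1 : C ^+ 2 <= (C + 1) ^+ 2 by rewrite ler_sqr ?nnegrE ?lerDl ?addr_ge0.
exists ((C + 1) ^+ 2); first by rewrite exprn_gt0// ltr_wpDl.
have weaken x : C ^+ 2 * rnorm x ^+ 2 <= (C + 1) ^+ 2 * rnorm (x : H) ^+ 2.
  by rewrite ler_wpM2r ?exprn_ge0 ?rnorm_ge0.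
split=> f N; apply: le_trans (weaken f).
  pose x n := (Num.conj (m n) * dot f (phi n)) *: psi n.
  have -> : \sum_(0 <= n < N) rnorm (dot f ((m n * `|psi n|) *: phi n)) ^+ 2 =
      \sum_(0 <= n < N) rnorm (x n) ^+ 2.
    apply: eq_bigr => n _; congr (_ ^+ 2).
    by rewrite (dotZr dot) rnormZ !rnormM !rnorm_conj rnormM rnorm_norm; ring.
  have [b hb] := exists_signs x N; apply: le_trans hb _.
  set y := \sum_(0 <= n < N) _.
  (* The signed bound passes to the adjoint by duality: [<y, y>] is the conjugate of [<S y, f>],
     where [S] is the signed partial sum of the multiplier itself. *)
  have : rnorm y ^+ 2 <= C * rnorm y * rnorm f.
    rewrite -[leLHS]ger0_norm ?exprn_ge0 ?rnorm_ge0// -rnorm_real -(dotxx dot_norm).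
    have -> : dot y y = Num.conj (dot
       (\sum_(0 <= n < N) (-1 : R[i]) ^+ b n *: multiplier_term dot m phi psi y n) f).
      rewrite {1}/y !(dot_suml dot) rmorph_sum; apply: eq_bigr => n _ /=.
      rewrite /x /multiplier_term !(dotZl dot) !rmorphM rmorph_sign.
      by rewrite (dotC dot f) (dotC dot (psi n)); ring.
    rewrite rnorm_conj; apply: le_trans (cauchy_schwarz dot_norm _ _) _.
    by rewrite ler_wpM2r ?rnorm_ge0.
  have := rnorm_ge0 y; rewrite le_eqVlt => /predU1P[<- _|y0].
    by rewrite expr0n mulr_ge0 ?exprn_ge0 ?rnorm_ge0.
  rewrite -mulrA (mulrC (rnorm y)) mulrA expr2 ler_pM2r// -exprMn => h.
  by rewrite -expr2 ler_sqr ?nnegrE ?mulr_ge0 ?rnorm_ge0.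
have -> : \sum_(0 <= n < N) rnorm (dot f ((Num.conj (m n) * `|phi n|) *: psi n)) ^+ 2 =
    \sum_(0 <= n < N) rnorm (multiplier_term dot m phi psi f n) ^+ 2.
  apply: eq_bigr => n _; congr (_ ^+ 2).
  rewrite (dotZr dot) rnormZ !rnormM rnorm_conj rnormM rnorm_conj rnorm_norm; ring.
have [b hb] := exists_signs (multiplier_term dot m phi psi f) N.
by apply: le_trans hb _; rewrite -exprMn ler_sqr ?nnegrE ?mulr_ge0 ?rnorm_ge0//.
Qed.

(** * The equivalence and the counterexample *)

Lemma P1_P2 m phi psi : multiplier_invertible dot m phi psi ->
  P1 dot m phi psi -> P2 dot m phi psi.
Proof.
move=> [cvM [T [Tb MT TM]]] [].
set x := (fun n => _ : R[i]); set a := inf (range (fun n => rnorm (x n))).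
rewrite /norm_bounded_below -/a => a0.
have ax n : a <= rnorm (m n) * rnorm (phi n) * rnorm (psi n).
  have -> : rnorm (m n) * rnorm (phi n) * rnorm (psi n) = rnorm (x n).
    by rewrite /x !rnormM !rnorm_norm.
  by apply: ge_inf; [exists 0 => _ [k _ <-]; exact: rnorm_ge0 | exists n].
move=> /unconditional_bessel[B B0 [phiB psiB]].
have m0 n : 0 < rnorm (m n).
  by rewrite lt_def rnorm_ge0 andbT; apply/eqP => h; have := ax n; rewrite h !mul0r; lra.
have phi0 n : 0 < rnorm (phi n).
  rewrite lt_def rnorm_ge0 andbT; apply/eqP => h; have := ax n.
  by rewrite h mulr0 mul0r; lra.
have psi0 n : 0 < rnorm (psi n).
  by rewrite lt_def rnorm_ge0 andbT; apply/eqP => h; have := ax n; rewrite h mulr0; lra.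
pose c n : R[i] := (`|phi n|)^-1; pose d n : R[i] := Num.conj (m n) * `|phi n|.
have cE n : rnorm (c n) = (rnorm (phi n))^-1 by rewrite rnormV rnorm_norm.
have dE n : rnorm (d n) = rnorm (m n) * rnorm (phi n).
  by rewrite rnormM rnorm_conj rnorm_norm.
have mcd n : m n = c n * Num.conj (d n).
  rewrite /c /d rmorphM/= conjCK conj_Creal ?ger0_real // mulrCA mulVf ?mulr1//.
  by rewrite normr_eq0 -rnorm_eq0 gt_eqF.
(* The lower bound [a] gives [|c_n| <= |m_n| |psi_n| / a], a comparison with the Bessel sequence of
   [phiB]. *)
have phiB' : bessel dot (B / a ^+ 2) (fun n => c n *: phi n).
  move=> h N; rewrite mulrAC ler_pdivlMr ?exprn_gt0//; apply: le_trans (phiB h N).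
  rewrite mulr_suml; apply: ler_sum => n _.
  rewrite -exprMn ler_sqr ?nnegrE ?mulr_ge0 ?rnorm_ge0 ?(ltW a0)//.
  rewrite !(dotZr dot) !rnormM !rnorm_conj rnormM rnorm_norm cE.
  rewrite mulrAC ler_wpM2r ?rnorm_ge0// ler_pdivrMl//.
  by have := ax n; rewrite mulrCA mulrA.
(* Test the Bessel inequality at the vector [d_n psi_n] and keep only its own term, of size
   [|d_n psi_n|^4]. *)
have Bn n : rnorm (d n *: psi n) ^+ 2 <= B.
  have [->|h0] := eqVneq (d n *: psi n) 0; first by rewrite rnorm0 expr0n ltW.
  have n0 : 0 < rnorm (d n *: psi n) by rewrite lt_def rnorm_eq0 h0 rnorm_ge0.
  have := psiB (d n *: psi n) n.+1; rewrite big_nat_recr//=.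
  rewrite -/(d n) (dotxx dot_norm) rnorm_real ger0_norm ?exprn_ge0 ?rnorm_ge0//.
  move=> h; rewrite -(ler_pM2r (exprn_gt0 2 n0)); apply: le_trans h.
  by rewrite -expr2 lerDr sumr_ge0// => i _; rewrite exprn_ge0 ?rnorm_ge0.
have termE f : multiplier_term dot m phi psi f =
    (fun n => dot f (d n *: psi n) *: (c n *: phi n)).
  apply: funext => n; rewrite /multiplier_term (dotZr dot) scalerA mcd.
  by congr (_ *: _); ring.
have B'0 : 0 < B / a ^+ 2 by rewrite divr_gt0 ?exprn_gt0.
(* The [eq_rect] rewrites only the series in [cvM f]; the limit remains the original multiplier,
   whose inverse is [T]. *)
have [frphi frpsi] := bessel_invertible_frames dot_norm B'0 B0 phiB' psiB
  (fun f => eq_rect _ (fun u => series u @ \oo --> _) (cvM f) _ (termE f)) Tb MT TM.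
exists c, d; split=> //.
  by exists 1, 1; split=> // n; rewrite rnormZ cE mulVf ?lexx// gt_eqF.
exists a, (Num.max a (Num.sqrt B)); split=> // [|n]; first by rewrite le_max lexx.
apply/andP; split; first by rewrite rnormZ dE.
rewrite le_max; apply/orP; right.
by rewrite -[leLHS]ger0_norm ?rnorm_ge0// -sqrtr_sqr ler_sqrt// ltW.
Qed.

Lemma P2_P1 m phi psi : P2 dot m phi psi -> P1 dot m phi psi.
Proof.
case=> c [d [mcd [a [b [a0 _ phi_a]]] [a' [b' [a'0 _ psi_a]]]]].
move=> /frame_bessel[B B0 phiB] /frame_bessel[B' _ psiB]; split.
  (* Since [m_n] is [c_n] times the conjugate of [d_n], the product of norms is
     [|c_n phi_n| |d_n psi_n|], hence at least [a * a']. *)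
  apply: (@lt_le_trans _ _ (a * a')); first exact: mulr_gt0.
  apply: lb_le_inf; first by exists (rnorm (`|m 0%N| * `|phi 0%N| * `|psi 0%N|)), 0%N.
  move=> _ [n _ <-]; have /andP[h _] := phi_a n; have /andP[h' _] := psi_a n.
  have := ler_pM (ltW a0) (ltW a'0) h h'; rewrite !rnormM !rnorm_norm !rnormZ mcd.
  by rewrite rnormM rnorm_conj mulrACA -mulrA mulrA mulrA.
move=> f s s_bij.
have -> : multiplier_term dot m phi psi f \o s =
    (fun n => dot f (d (s n) *: psi (s n)) *: (c (s n) *: phi (s n))).
  apply: funext => n; rewrite /= /multiplier_term (dotZr dot) scalerA mcd.
  by congr (_ *: _); ring.
have s_inj := bij_inj s_bij.
have h := bessel_cvg dot_norm B0 (bessel_comp s_inj phiB) (bessel_comp s_inj psiB).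
exact: h.
Qed.

Lemma resolution_invertible phi :
  (forall f, series (fun n => dot f (phi n) *: phi n) @ \oo --> f) ->
  multiplier_invertible dot (fun=> 1) phi phi.
Proof.
move=> res.
have termE f : multiplier_term dot (fun=> 1) phi phi f =
    (fun n => dot f (phi n) *: phi n).
  by apply: funext => n; rewrite /multiplier_term mul1r.
have ME f : multiplier dot (fun=> 1) phi phi f = f.
  by rewrite /multiplier termE; apply: cvg_lim => //; exact: res.
split=> [f|]; first by rewrite termE; apply/cvg_ex; exists f; exact: res.
by exists idfun; split=> //; exists 1 => x; rewrite mul1r.
Qed.

(** The zero vector put in front only shifts the partial sums of basis expansions, so the multiplier
    is the identity and [phi] a frame, while the product of norms at index 0 vanishes. *)
Lemma P3_not_P1 (e : nat -> H) : orthonormal_basis dot e ->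
  exists m phi psi, [/\ multiplier_invertible dot m phi psi,
    P3 dot m phi psi & ~ P1 dot m phi psi].
Proof.
move=> [_ e_res]; pose phi n := if n is k.+1 then e k else 0.
have res f : series (fun n => dot f (phi n) *: phi n) @ \oo --> f.
  rewrite -cvg_shiftS; apply: cvg_trans (e_res f).
  suff -> : [sequence series (fun n => dot f (phi n) *: phi n) n.+1]_n =
    series (fun n => dot f (e n) *: e n) by [].
  by apply: funext => n; rewrite /series/= big_nat_recl//= scaler0 add0r.
exists (fun=> 1), phi, phi; split; first exact: resolution_invertible.
  have frphi := resolution_frame dot_norm res.
  have phi1 : (fun n => (1 : R[i]) *: phi n) = phi.
    by apply: funext => n; rewrite scale1r.
  by exists (fun=> 1), (fun=> 1); rewrite phi1; split=> // n; rewrite conjC1 mulr1.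
case=> + _; apply/negP; rewrite -leNgt; apply: ge_inf.
  by exists 0 => _ [k _ <-]; exact: rnorm_ge0.
by exists 0%N => //=; rewrite normr0 mulr0 rnorm0.
Qed.

End UnconditionalConvergence.

Theorem corollary4p4 (R : realType) (H : completeNormedModType R[i])
    (dot : {dot H for (@Num.conj R[i])}) (dot_norm : induces_norm dot)
    (e : nat -> H) (basis_e : orthonormal_basis dot e) :
  (forall (m : nat -> R[i]) (phi psi : nat -> H),
     multiplier_invertible dot m phi psi ->
     (P1 dot m phi psi <-> P2 dot m phi psi) /\
     (P2 dot m phi psi -> P3 dot m phi psi)) /\
  (exists (m : nat -> R[i]) (phi psi : nat -> H),
     [/\ multiplier_invertible dot m phi psi,
         P3 dot m phi psi &
         ~ P1 dot m phi psi]).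
Proof.
split=> [m phi psi inv|]; last exact: P3_not_P1 basis_e.
split; first by split; [exact: P1_P2 | exact: P2_P1].
by case=> c [d [mcd _ _ frphi frpsi]]; exists c, d.
Qed.
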